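(* Let $(\mathcal X,\mathscr X)$ be a measurable space, let $(\mathcal Y,\mathscr Y,\nu)$ be a finite measure space with $\nu$ normalized according to $\nu(\mathcal Y)=1$, and let $\rho\colon\mathcal X\times\mathcal Y\to[0,\infty]$ be a distortion function. Let $k\in(0,\infty)$, suppose that $\nu$ is $\rho^{1/k}$-superregular of dimension $m\in(0,\infty)$ with superregularity constants $b\in(0,\infty)$ and $\delta_0\in(0,\infty]$, and assume that $$\operatorname*{ess\,sup}_{y\in\mathcal Y}\ \sup_{x\in\mathcal X}\rho^{1/k}(x,y)<\infty\quad\text{if }\delta_0<\infty.$$ Let $X$ be a random variable taking values in $(\mathcal X,\mathscr X)$. Then the following statements hold: (i) $\overline D_k(X)\le m$. (ii) If $D_k(X)=m$ (i.e., the $k$-th quantization dimension exists and equals $m$), then $$\overline C_k(X)\le\Gamma\left(1+\frac km\right)b^{-\frac km}.$$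
   Context: All measures are positive, and $\sigma$-algebras contain all singletons. A distortion function $\rho\colon\mathcal X\times\mathcal Y\to[0,\infty]$ is a function measurable with respect to the product $\sigma$-algebra. $\log$ is the natural logarithm. For a distortion function $\varrho$ on $\mathcal X\times\mathcal Y$, a measure $\nu$ on $(\mathcal Y,\mathscr Y)$ is $\varrho$-superregular of dimension $m\in[0,\infty)$ with superregularity constants $b\in(0,\infty)$ and $\delta_0\in(0,\infty]$ if $\nu(\{y\in\mathcal Y:\varrho(x,y)<\delta\})\ge b\,\delta^m$ for all $x\in\mathcal X$ and $\delta\in(0,\delta_0)$. The essential supremum over $y\in\mathcal Y$ is with respect to $\nu$, i.e. the infimum of all $a\in[0,\infty]$ such that $\sup_{x\in\mathcal X}\rho^{1/k}(x,y)\le a$ for $\nu$-almost all $y$. $n$-th quantization error: $V_n(X)=\inf_{f}\mathbb E[\rho(X,f(X))]$ over all measurable $f\colon\mathcal X\to\mathcal Y$ with $|f(\mathcal X)|\le n$. Lower and upper $k$-th quantization dimensions: $$\underline D_k(X)=\liminf_{n\to\infty}\frac{k\log n}{\log(1/V_n(X))},\qquad\overline D_k(X)=\limsup_{n\to\infty}\frac{k\log n}{\log(1/V_n(X))}.$$ Conventions: the quotient is $0$ if $V_n(X)=0$; if $\lim_{n\to\infty}V_n(X)>0$, then $\underline D_k(X)=\overline D_k(X)=\infty$. If $\underline D_k(X)=\overline D_k(X)$, the common value is denoted $D_k(X)$ (the $k$-th quantization dimension). If $D_k(X)$ exists in $(0,\infty)$, the upper $k$-th quantization coefficient is $\overline C_k(X)=\limsup_{n\to\infty}n^{k/D_k(X)}V_n(X)$.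 *)

(* Defs.v *)
From HB Require Import structures.
From mathcomp Require Import all_boot all_order all_algebra.
From mathcomp Require Import all_classical all_reals all_analysis.
From mathcomp Require Import measurable_realfun ess_sup_inf.

Set Implicit Arguments.
Unset Strict Implicit.
Unset Printing Implicit Defensive.

Import Order.TTheory GRing.Theory Num.Theory.
Import numFieldNormedType.Exports.

Local Open Scope classical_set_scope.
Local Open Scope ring_scope.
Local Open Scope ereal_scope.

Section quantization.
Context {R : realType} {dX dY : measure_display}.
Context {TX : measurableType dX} {TY : measurableType dY}.
Implicit Type rho : TX * TY -> \bar R.

Definition distortion_function rho : Prop :=
  measurable_fun [set: TX * TY] rho /\ forall z, 0 <= rho z.

Definition superregular rho (nu : {measure set TY -> \bar R})
    (m b : R) (delta0 : \bar R) : Prop :=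
  [/\ (0 <= m)%R, (0 < b)%R, 0 < delta0 &
    forall (x : TX) (delta : R), (0 < delta)%R -> delta%:E < delta0 ->
      (b * delta `^ m)%:E <= nu [set y | rho (x, y) < delta%:E]].

Context {d : measure_display} {Omega : measurableType d}.
Variables (P : probability Omega R) (X : {RV P >-> TX}).

(* The expectation is an extended-real integral, as [rho] may take the value
   [+oo]; the library's ['E_P] only covers real-valued random variables. *)
Definition quantization_error rho (n : nat) : \bar R :=
  ereal_inf [set \int[P]_w rho (X w, f (X w)) |
              f in [set f : {mfun TX >-> TY} | (range f #<= `I_n)%card]].

Definition quantization_quotient rho (k : R) (n : nat) : \bar R :=
  let V := quantization_error rho n in
  if V == 0 then 0 else (k * ln n%:R)%:E / lne V^-1.

(* The sequence of quantization errors is nonincreasing, so [limn] is its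
   genuine limit. The values of [quantization_quotient] at the [n] with
   [1 <= quantization_error rho n] never matter: if the limit is [0], there
   are only finitely many such [n]. *)
Definition lower_quantization_dim rho (k : R) : \bar R :=
  if 0 < limn (quantization_error rho) then +oo
  else limn_einf (quantization_quotient rho k).

Definition upper_quantization_dim rho (k : R) : \bar R :=
  if 0 < limn (quantization_error rho) then +oo
  else limn_esup (quantization_quotient rho k).

Definition is_quantization_dim rho (k : R) (D : \bar R) : Prop :=
  lower_quantization_dim rho k = D /\ upper_quantization_dim rho k = D.

(* Only meaningful when the quantization dimension exists in ]0, +oo[; it is
   then equal to the upper quantization dimension. *)
Definition upper_quantization_coef rho (k : R) : \bar R :=
  let D := fine (upper_quantization_dim rho k) in
  limn_esup (fun n : nat =>
    (n%:R `^ (k / D))%:E * quantization_error rho n).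

End quantization.

(* Euler's Gamma function, for [0 < s]. *)
Definition Gamma {R : realType} (s : R) : R :=
  (\int[lebesgue_measure]_(t in `]0%R, +oo[) (t `^ (s - 1) * expR (- t)))%R.

(* Main.v *)
Require Import Defs.
From HB Require Import structures.
From mathcomp Require Import all_boot all_order all_algebra.
From mathcomp Require Import all_classical all_reals all_analysis.
From mathcomp Require Import measurable_realfun ess_sup_inf.
From mathcomp Require Import ring.

(** The proof is a random coding argument. Draw [n] codewords independently
    from [nu] and send each point to the nearest one. For a fixed [x], the
    distortion exceeds [t] when all codewords miss the ball
    [rho (x, .) <= t], which has probability [nu (rho (x, .) > t) ^ n]. By
    superregularity this is at most [(1 - b * t^(m/k))^n <=
    exp (- n * b * t^(m/k))] as long as [t] is small; for larger [t] it is at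
    most [exp (- n * c)] with [c > 0] independent of [t], and [t] never has to
    exceed the essential bound [T] of [rho]. Integrating over [t],
<<
      V_n <= \int_0^oo exp (- n * b * t^(m/k)) dt + T * exp (- n * c)
           = (n * b)^(- k/m) * Gamma (1 + k/m) + T * exp (- n * c).
>>
    Hence the limsup of [n^(k/m) * V_n] is at most
    [Gamma (1 + k/m) * b^(- k/m)], which is (ii), and [V_n] is
    [O(n^(- k/m))], which gives (i) after taking logarithms.

    No product of [n] copies of [nu] is formed: the codewords are chosen one
    after the other by the method of conditional expectations. On the space of
    pairs [(w, t)], a codeword [y] leaves uncovered the pairs with
    [t < rho (X w, y)], and [exists_points_unhit_le] shows in general that
    suitable points [y_1, ..., y_n] leave uncovered no more measure than random
    ones do on average. The measure left over is the mean distortion of the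
    nearest-codeword quantizer, since [rho (X w, f (X w))] is the length of the
    uncovered part over [w]; this is [quantization_error_le_integral]. The Gamma
    function comes from [integral_expR_powR].

    The case [delta0 = +oo] cannot occur, because a probability measure cannot
    dominate [b * delta ^ m] for all [delta]; so the essential bound is always
    available. *)

Set Implicit Arguments.
Unset Strict Implicit.
Unset Printing Implicit Defensive.

Import Order.TTheory GRing.Theory Num.Theory.
Import numFieldNormedType.Exports.

Local Open Scope classical_set_scope.
Local Open Scope ring_scope.
Local Open Scope ereal_scope.

(** * Derandomization *)

(** If [f] exceeded its mean almost surely, then [f] minus its mean would be
    almost surely positive with integral zero. *)
Lemma exists_le_expectation (R : realType) (d : measure_display)
    (T : measurableType d) (Q : probability T R) (f : T -> \bar R)
    (A : T -> Prop) :
  measurable_fun [set: T] f -> (forall y, 0 <= f y) ->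
  (\forall y \ae Q, A y) -> exists2 y, A y & f y <= \int[Q]_y f y.
Proof.
move=> mf f0 aeA; apply: contrapT => noy.
have QT0 : 0 < Q [set: T] by rewrite probability_setT.
have aeproper := ae_properfilter_algebraOfSetsType QT0.
have lt_f y : A y -> \int[Q]_y f y < f y.
  by move=> Ay; rewrite ltNge; apply/negP => le_f; apply: noy; exists y.
have [c cE] : exists c, c = \int[Q]_y f y by exists (\int[Q]_y f y).
rewrite -cE in lt_f noy.
have cfin : c \is a fin_num.
  rewrite ge0_fin_numE; last by rewrite cE integral_ge0.
  have [y Ay] := @filter_ex _ _ _ _ aeA.
  by rewrite (lt_le_trans (lt_f _ Ay)) ?leey.
have fint : Q.-integrable setT f.
  apply/integrableP; split => //.
  under eq_integral do rewrite gee0_abs//.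
  by rewrite -cE -ge0_fin_numE// cE integral_ge0.
have cint : Q.-integrable setT (fun=> c).
  by rewrite -(fineK cfin); apply: finite_measure_integrable_cst.
have int0 : \int[Q]_y (f y - c) = 0.
  rewrite (integralB measurableT fint cint).
  by rewrite integral_cst// -cE [X in _ * X]probability_setT mule1 subee.
have mfc : measurable_fun setT (fun y => f y - c).
  by apply: emeasurable_funB => //; exact: measurable_cst.
have abs0 : \int[Q]_y `|f y - c| = 0.
  rewrite -[RHS]int0; apply: ae_eq_integral => //.
    exact: measurableT_comp.
  apply: filterS aeA => y Ay _; rewrite gee0_abs// sube_ge0 ?cfin//.
  exact/ltW/lt_f.
have /(ae_eq_integral_abs Q measurableT mfc) ae0 := abs0.
have [y [Ay /(_ I)/= fyc]] := @filter_ex _ _ _ _ (filterI aeA ae0).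
by have := lt_f _ Ay; rewrite -sube_gt0 fyc ltxx.
Qed.

(** Read [S (z, y)] as: the point [y] does not hit [z]. For [n] independent
    points of law [Q], the expected measure of the part of [E] hit by none of
    them is the integral of [Q (xsection S z) ^ n] over [E]; so some choice of
    points does at least as well. The points are picked one by one: by Tonelli
    the mean over [y] of the bound for [E `&` ysection S y] with [n] points is
    at most the bound for [E] with [n.+1] points. The predicate [A] confines
    the points to a set of full measure. *)
Lemma exists_points_unhit_le (R : realType) (dZ dY : measure_display)
    (Z : measurableType dZ) (Y : measurableType dY)
    (mu : {sigma_finite_measure set Z -> \bar R}) (Q : probability Y R)
    (S : set (Z * Y)) (h : Z -> R) (A : Y -> Prop) :
  measurable S -> measurable_fun [set: Z] h -> (forall z, (0 <= h z)%R) ->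
  (forall z, Q (xsection S z) <= (h z)%:E) -> (\forall y \ae Q, A y) ->
  forall (n : nat) (E : set Z), measurable E ->
  exists s : seq Y, [/\ size s = n, forall y, y \in s -> A y &
    mu (E `&` [set z | forall y, y \in s -> S (z, y)]) <=
      \int[mu]_(z in E) (h z ^+ n)%:E].
Proof.
move=> mS mh h0 Qh aeA; elim=> [|n IHn] E mE.
  exists [::]; split => //; rewrite (_ : _ `&` _ = E).
    by under eq_integral do rewrite expr0; rewrite integral_cst// mul1e.
  by apply/seteqP; split => [z []//|z Ez]; split.
(* The mean of [f] below is at most the bound for [n.+1] points: integrating
   out [y] turns the indicator of [S] into one more factor [h z]. *)
pose F (p : Z * Y) : \bar R := ((h p.1 ^+ n * \1_E p.1) * \1_S p)%:E.
have F0 p : 0 <= F p by rewrite lee_fin !mulr_ge0// exprn_ge0.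
have mhn : measurable_fun [set: Z] (fun z => h z ^+ n)%R.
  exact: measurable_funX.
have mF : measurable_fun [set: Z * Y] F.
  apply/measurable_EFinP; apply: measurable_funM; last exact: measurable_indic.
  apply: (measurableT_comp (f := fun z => (h z ^+ n * \1_E z)%R)) => //.
  by apply: measurable_funM => //; exact: measurable_indic.
pose f y := \int[mu]_z F (z, y).
have mf : measurable_fun [set: Y] f.
  exact: measurable_fun_fubini_tonelli_G.
have f0 y : 0 <= f y by exact: integral_ge0.
have [y Ay fy] := exists_le_expectation mf f0 aeA.
have mEy : measurable (E `&` ysection S y).
  by apply: measurableI => //; exact: measurable_ysection.
have [s [sn sA mus]] := IHn _ mEy.
exists (y :: s); split => [|z|]; first by rewrite /= sn.
  by rewrite inE => /orP[/eqP ->//|]; exact: sA.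
rewrite (_ : _ `&` _ = (E `&` ysection S y) `&`
    [set z | forall y, y \in s -> S (z, y)]); last first.
  apply/seteqP; split => z.
    move=> [Ez ys]; split; first split => //.
      by rewrite /ysection/= inE; apply: ys; rewrite mem_head.
    by move=> y' y's; apply: ys; rewrite inE y's orbT.
  move=> [[Ez]]; rewrite /ysection/= inE => Szy zs; split => // y'.
  by rewrite inE => /orP[/eqP ->//|]; exact: zs.
apply: (le_trans mus).
have -> : \int[mu]_(z in E `&` ysection S y) (h z ^+ n)%:E = f y.
  rewrite integral_mkcond; apply: eq_integral => z _.
  rewrite /F /= patchE in_setI !indicE mem_ysection.
  by case: ifPn; case: (z \in E); case: (_ \in S);
    rewrite ?(mulr1, mulr0, mul0r).
apply: (le_trans fy).
rewrite -(fubini_tonelli F mF F0) [leRHS]integral_mkcond.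
apply: ge0_le_integral => //.
- by move=> z _; exact: integral_ge0.
- exact: measurable_fun_fubini_tonelli_F.
- apply/(measurable_restrictT _ mE).
  apply/measurable_EFinP; apply: measurable_funTS; exact: measurable_funX.
move=> z _; rewrite patchE.
have -> : \int[Q]_x F (z, x) = (h z ^+ n * \1_E z)%:E * Q (xsection S z).
  rewrite /F /=.
  under eq_integral do rewrite EFinM.
  rewrite ge0_integralZl//.
  + congr (_ * _); rewrite -[xsection S z]setIT -integral_indic//; last first.
      exact: measurable_xsection.
    by apply: eq_integral => y' _; rewrite !indicE mem_xsection.
  + apply/measurable_EFinP; apply: measurableT_comp.
      exact: measurable_indic.
    exact: pair1_measurable.
  + by rewrite lee_fin mulr_ge0// exprn_ge0.
rewrite indicE; case: ifPn => Ez; rewrite ?mulr0 ?mul0e// mulr1.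
by rewrite exprSr EFinM lee_pmul// ?lee_fin ?exprn_ge0.
Qed.

(** * Random coding bound for the quantization error *)

Lemma measurable_all_sections (dZ dY : measure_display)
    (Z : measurableType dZ) (Y : measurableType dY) (S : set (Z * Y))
    (s : seq Y) :
  measurable S -> measurable [set z | forall y, y \in s -> S (z, y)].
Proof.
move=> mS; elim: s => [|y s IHs].
  by rewrite (_ : [set _ | _] = setT)//; apply/seteqP; split.
rewrite (_ : [set _ | _] =
    ysection S y `&` [set z | forall y, y \in s -> S (z, y)]).
  by apply: measurableI => //; exact: measurable_ysection.
apply/seteqP; split => z /=.
  move=> zs; rewrite /ysection/= inE; split.
    by apply: zs; rewrite mem_head.
  by move=> y' y's; apply: zs; rewrite inE y's orbT.
rewrite /ysection/= inE => -[Szy zs] y'.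
by rewrite inE => /orP[/eqP ->//|]; exact: zs.
Qed.

Lemma nearest_codeword (R : realType) (dX dY : measure_display)
    (TX : measurableType dX) (TY : measurableType dY)
    (rho : TX * TY -> \bar R) (y0 : TY) (s : seq TY) :
  measurable_fun [set: TX * TY] rho ->
  exists f : {mfun TX >-> TY}, range f `<=` [set` y0 :: s] /\
    forall x y, y \in y0 :: s -> rho (x, f x) <= rho (x, y).
Proof.
move=> mrho; elim: s y0 => [|y1 s IHs] y0.
  exists (cst y0 : {mfun TX >-> TY}); split.
    by move=> _ [x _ <-] /=; rewrite mem_head.
  by move=> x y; rewrite inE => /eqP ->.
have [g [gs gle]] := IHs y1.
pose f x := if rho (x, y0) <= rho (x, g x) then y0 else g x.
have mf : measurable_fun [set: TX] f.
  apply: measurable_fun_ifT => //.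
  apply: measurable_fun_lee.
    apply: measurableT_comp => //; exact: pair2_measurable.
  by apply: measurableT_comp => //; exact: measurable_fun_pair.
exists (HB.pack f (isMeasurableFun.Build _ _ _ _ f mf) : {mfun TX >-> TY}).
split => [_ [x _ <-]|x y] /=.
  rewrite /f in_cons; case: ifPn => _; first by rewrite eqxx.
  have : g x \in y1 :: s by apply: gs; exists x.
  by move=> ->; rewrite orbT.
rewrite in_cons /f => /orP[/eqP ->|ys].
  by case: ifPn => // /negP/negP; rewrite -ltNge => /ltW.
case: ifPn => [le_y0|_]; last exact: gle.
exact: le_trans le_y0 (gle _ _ ys).
Qed.

Lemma card_le_seq (T : eqType) (y0 : T) (s : seq T) (B : set T) :
  B `<=` [set` s] -> (B #<= `I_(size s))%card.
Proof.
move=> Bs; apply: card_le_trans (card_image_le (nth y0 s) `I_(size s)).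
apply: subset_card_le => y /Bs ys.
by exists (index y s); rewrite /= ?index_mem// nth_index.
Qed.

(** The layer cake formula in its simplest form; it turns a mean distortion into
    the measure of a set of pairs [(w, t)]. *)
Lemma lebesgue_measure_below (R : realType) (x : \bar R) : 0 <= x ->
  lebesgue_measure [set t : R | (0 <= t)%R /\ t%:E < x] = x.
Proof.
case: x => [r| |//] r0.
- rewrite (_ : [set _ | _] = `[0%R, r[%classic).
    rewrite lebesgue_measure_itv/= lte_fin oppr0 adde0.
    case: ifPn => //; rewrite -leNgt => r_le0.
    by apply/eqP; rewrite eq_le r0 lee_fin r_le0.
  by apply/seteqP; split => t /=; rewrite in_itv/= lte_fin => /andP.
- rewrite (_ : [set _ | _] = `[0%R, +oo[%classic).
    by rewrite lebesgue_measure_itv/= ltry oppr0 adde0.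
  by apply/seteqP; split => t /=; rewrite in_itv/= andbT ?ltry => // -[].
Qed.

Lemma sigma_finite_probability_prod (R : realType) (d1 d2 : measure_display)
    (T1 : measurableType d1) (T2 : measurableType d2) (P : probability T1 R)
    (m2 : {sigma_finite_measure set T2 -> \bar R}) :
  sigma_finite setT (P \x m2).
Proof.
have [F TF Foo] := sigma_finiteT m2.
exists (fun n => setT `*` F n) => [|n].
  by rewrite -setX_bigcupr -TF setXTT.
have [mF Flty] := Foo n; split; first exact: measurableX.
by rewrite product_measure1E// [X in X * _]probability_setT mul1e.
Qed.

(** The function [h] bounds, uniformly in [x], the probability that one random
    codeword has distortion greater than [t], so [h t ^+ n] does so for the best
    of [n] codewords. The integral stops at [T] because every admissible
    codeword has distortion at most [T]. *)
Lemma quantization_error_le_integral (R : realType) (dX dY d : measure_display)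
    (TX : measurableType dX) (TY : measurableType dY) (Q : probability TY R)
    (rho : TX * TY -> \bar R) (Omega : measurableType d)
    (P : probability Omega R) (X : {RV P >-> TX}) (T : R) (h : R -> R)
    (n : nat) :
  distortion_function rho ->
  (\forall y \ae Q, forall x, rho (x, y) <= T%:E) ->
  measurable_fun [set: R] h -> (forall t, (0 <= h t)%R) ->
  (forall x t, (0 <= t)%R -> Q [set y | t%:E < rho (x, y)] <= (h t)%:E) ->
  (0 < n)%N ->
  quantization_error X rho n <=
    \int[lebesgue_measure]_(t in `[0%R, T[) (h t ^+ n)%:E.
Proof.
move=> [mrho rho0] rhoT mh h0 Qh n_gt0.
pose GR := measurableTypeR R.
(* The pairs [(w, t)] that a codeword leaves uncovered. *)
pose S : set ((Omega * GR) * TY) :=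
  [set p | (0 <= p.1.2)%R /\ p.1.2%:E < rho (X p.1.1, p.2)].
have mS : measurable S.
  rewrite (_ : S = [set p | 0 <= p.1.2%:E] `&`
                   [set p | p.1.2%:E < rho (X p.1.1, p.2)]); last first.
    by apply/seteqP; split => p; rewrite /S/= lee_fin.
  have m12 : measurable_fun [set: (Omega * GR) * TY]
      (fun p => p.1.2%:E : \bar R).
    by apply/measurable_EFinP; exact: measurableT_comp.
  apply: measurableI.
    by rewrite -[X in measurable X]setTI; apply: measurable_lee.
  rewrite -[X in measurable X]setTI; apply: measurable_lte => //.
  apply: measurableT_comp => //; apply: measurable_fun_pair => //.
  by apply: measurableT_comp => //; exact: measurableT_comp.
pose E : set (Omega * GR) := [set: Omega] `*` `[0%R, T[.
have mE : measurable E by apply: measurableX => //; exact: measurable_itv.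
have QS z : Q (xsection S z) <= (h z.2)%:E.
  have [t0|t0] := leP 0%R z.2.
    rewrite (_ : xsection S z = [set y | z.2%:E < rho (X z.1, y)]).
      exact: Qh.
    by apply/seteqP; split => y; rewrite /xsection/= inE /S/= => // -[].
  rewrite (_ : xsection S z = set0) ?measure0 ?lee_fin//.
  by rewrite -subset0 => y; rewrite /xsection/= inE /S/= leNgt t0 => -[].
pose leb : {sigma_finite_measure set GR -> \bar R} := @lebesgue_measure R.
pose mu : {sigma_finite_measure set (Omega * GR)%type -> \bar R} :=
  HB.pack (P \x leb)
    (Measure_isSigmaFinite.Build _ _ _ _ (sigma_finite_probability_prod P leb)).
have [|s [sn sA]] := exists_points_unhit_le mu
  mS _ (fun z => h0 z.2) QS rhoT n mE; first exact: measurableT_comp.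
case: s sn sA => [|y0 s] sn sA; first by rewrite -sn in n_gt0.
move=> mu_le.
have [f [fs fle]] := nearest_codeword y0 s mrho.
apply: (@le_trans _ _ (\int[P]_w rho (X w, f (X w)))).
  apply: ereal_inf_lbound; exists f => //=.
  by rewrite -sn; exact: card_le_seq y0 _ _ fs.
set C := E `&` _ in mu_le.
have mC : measurable C.
  by apply: measurableI => //; exact: measurable_all_sections.
have mrhoX : measurable_fun [set: Omega] (fun w => rho (X w, f (X w))).
  apply: measurableT_comp => //; apply: measurable_fun_pair => //.
  exact: measurableT_comp.
apply: (@le_trans _ _ ((P \x leb) C)).
  apply: ge0_le_integral => //.
    exact: measurable_fun_xsection.
  (* Each [t] below the distortion of the nearest codeword is uncovered. *)
  move=> w _ /=; rewrite -[leLHS]lebesgue_measure_below//.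
  apply: le_measure; rewrite ?inE.
  - rewrite (_ : [set _ | _] = [set t : R | 0 <= t%:E] `&`
                [set t : R | t%:E < rho (X w, f (X w))]); last first.
      by apply/seteqP; split => t /=; rewrite lee_fin.
    apply: measurableI.
      by rewrite -[X in measurable X]setTI; apply: measurable_lee.
    by rewrite -[X in measurable X]setTI; apply: measurable_lte.
  - exact: measurable_xsection.
  - move=> t /= [t0 lt_t]; rewrite /xsection/= inE; split; first split => //=.
      rewrite in_itv/= t0/= -lte_fin (lt_le_trans lt_t)//.
      apply: (le_trans (fle _ _ (mem_head _ _))).
      exact: (sA _ (mem_head _ _)).
    move=> y ys; split => //=; apply: (lt_le_trans lt_t); exact: fle.
apply: (le_trans mu_le).
pose G : Omega * GR -> \bar R := (fun z => (h z.2 ^+ n)%:E) \_ E.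
have G0 z : 0 <= G z.
  by rewrite /G patchE; case: ifPn => _ //; rewrite lee_fin exprn_ge0.
have mG : measurable_fun setT G.
  apply/(measurable_restrictT _ mE)/measurable_EFinP/measurable_funTS.
  by apply: measurable_funX; exact: measurableT_comp.
rewrite integral_mkcond (fubini_tonelli1 (m1 := P) (m2 := leb) G mG G0).
rewrite (_ : fubini_F leb G =
    cst (\int[leb]_(t in `[0%R, T[) (h t ^+ n)%:E)).
  by rewrite integral_cst// [X in _ * X]probability_setT mule1.
apply/funext => w; rewrite /fubini_F [RHS]integral_mkcond.
by apply: eq_integral => t _; rewrite /G !patchE in_setX in_setT.
Qed.

(** * Integrals of exponentials and the Gamma function *)

(** This is the [p]-th power of [y <= expR y] at [y := e * x / p]. It serves both
    for the finiteness of the Gamma integral and for the decay of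
    [n ^ p * exp (- n * c)]. *)
Lemma powR_le_expR (R : realType) (p e x : R) :
  (0 < p -> 0 < e -> 0 <= x -> x `^ p <= (p / e) `^ p * expR (e * x))%R.
Proof.
move=> p0 e0 x0.
have pe0 : (0 < p / e)%R by rewrite divr_gt0.
have -> : x = (p / e * (e * x / p))%R.
  by field; rewrite !gt_eqF.
set y := (e * x / p)%R.
have y0 : (0 <= y)%R by rewrite divr_ge0 ?mulr_ge0// ltW.
rewrite (powRM _ (ltW pe0) y0) ler_pM2l ?powR_gt0//.
have -> : (e * (p / e * y) = y * p)%R by field; rewrite gt_eqF.
rewrite expRM; apply: ge0_ler_powR; rewrite ?nnegrE ?expR_ge0 ?(ltW p0)//.
by apply: le_trans (expR_ge1Dx y); rewrite lerDr.
Qed.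

Lemma continuous_expRN (R : realType) (c : R) :
  continuous (fun u : R => expR (- (c * u)))%R.
Proof.
by move=> u; apply/differentiable_continuous/derivable1_diffP; exact: ex_derive.
Qed.

Lemma integral_expR_tail (R : realType) (c x : R) : (0 < c)%R ->
  \int[lebesgue_measure]_(u in `]x, +oo[) (c * expR (- (c * u)))%:E =
    (expR (- (c * x)))%:E.
Proof.
move=> c0.
have cvgl : (fun u : R => - expR (- (c * u)))%R @ +oo%R --> (0 : R)%R.
  rewrite -oppr0; apply: cvgN.
  apply: (@cvg_comp _ _ _ (fun u => c * u)%R (fun u => expR (- u)) _
    (pinfty_nbhs R)); last exact: cvgr_expR.
  exact: gt0_cvgMry.
have dF (u : R) : is_derive u 1%R (fun u : R => - expR (- (c * u)))%R
    (c * expR (- (c * u)))%R.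
  by apply: is_derive_eq; rewrite /GRing.scale/=; ring.
have cE := @continuous_expRN R c.
have cF : continuous (fun u : R => - expR (- (c * u)))%R.
  by move=> u; apply: cvgN; exact: cE.
have cf : continuous (fun u : R => c * expR (- (c * u)))%R.
  by move=> u; apply: cvgM; [exact: cvg_cst|exact: cE].
rewrite integral_itv_obnd_cbnd; last first.
  by apply/measurable_EFinP/measurable_funTS; exact: continuous_measurable_fun.
rewrite (@ge0_continuous_FTC2y _ _ (fun u => - expR (- (c * u)))%R _ 0%R)//.
- by rewrite EFinN oppeK add0e.
- by move=> u _; rewrite mulr_ge0 ?expR_ge0 ?ltW.
- exact: continuous_subspaceT.
- exact/cvg_at_right_filter/cF.
- by move=> u _; rewrite derive1E derive_val.
Qed.

(** As [Gamma] is a real-valued integral, it would be [0] if the integral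
    diverged; domination by a multiple of [expR (- u / 2)] rules this out. *)
Lemma GammaE (R : realType) (p : R) : (0 < p)%R ->
  (Gamma (1 + p))%:E =
  \int[lebesgue_measure]_(u in `]0%R, +oo[) (u `^ p * expR (- u))%:E.
Proof.
move=> p0; rewrite /Gamma /Rintegral addrC addKr fineK// ge0_fin_numE;
  last first.
  by apply: integral_ge0 => u _; rewrite lee_fin mulr_ge0 ?powR_ge0 ?expR_ge0.
have hm : measurable_fun [set: R] (fun u => expR (- (2^-1 * u)))%R.
  by apply: continuous_measurable_fun; apply: continuous_expRN.
have e2 : (0 < 2^-1 :> R)%R by [].
apply: (@le_lt_trans _ _ (\int[lebesgue_measure]_(u in `]0%R, +oo[)
    (((p / 2^-1) `^ p * 2)%:E * (2^-1 * expR (- (2^-1 * u)))%:E))).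
  apply: ge0_le_integral => //.
  - by move=> u _; rewrite lee_fin mulr_ge0 ?powR_ge0 ?expR_ge0.
  - apply/measurable_EFinP; apply: measurable_funTS; apply: measurable_funM.
      exact: measurable_powR.
    by apply: measurableT_comp => //; exact: measurableT_comp.
  - apply/measurable_EFinP/measurable_funTS; apply: measurable_funM => //.
    exact: measurable_funM.
  - move=> u; rewrite /= in_itv/= andbT => u0; rewrite lee_fin.
    rewrite [leRHS](_ : _ = (p / 2^-1) `^ p * expR (2^-1 * u) * expR (- u))%R.
      by rewrite ler_pM2r ?expR_gt0// powR_le_expR// ltW.
    rewrite -[RHS]mulrA -expRD (_ : 2^-1 * u - u = - (2^-1 * u))%R.
      by field.
    by field.
rewrite ge0_integralZl//.
- by rewrite integral_expR_tail// -EFinM ltry.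
- apply/measurable_EFinP; apply: measurable_funTS; exact: measurable_funM.
- by rewrite lee_fin mulr_ge0 ?powR_ge0.
Qed.

Lemma ltr_powRVr (R : realType) (a t v : R) :
  (0 < a -> 0 <= t -> 0 <= v -> (t < v `^ a^-1) = (t `^ a < v))%R.
Proof.
move=> a0 t0 v0.
have ia0 : (0 < a^-1)%R by rewrite invr_gt0.
apply/idP/idP => [/(gt0_ltr_powR a0)|/(gt0_ltr_powR ia0)].
  by rewrite !nnegrE powR_ge0 -powRrM mulVf ?gt_eqF// powRr1//; exact.
by rewrite !nnegrE powR_ge0 -powRrM mulfV ?gt_eqF// powRr1//; exact.
Qed.

(** Writing [expR (- v)] as the integral of [expR (- u)] over [u > v] and
    exchanging the integrals replaces the change of variables and the
    functional equation of Gamma: for fixed [u], the set of [t >= 0] with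
    [c * t ^ a < u] has length [(u / c) ^ (1 / a)]. *)
Lemma integral_expR_powR (R : realType) (a c : R) : (0 < a)%R -> (0 < c)%R ->
  \int[lebesgue_measure]_(t in `[0%R, +oo[) (expR (- (c * t `^ a)))%:E =
    (c `^ (- a^-1) * Gamma (1 + a^-1))%:E.
Proof.
move=> a0 c0.
have ia0 : (0 < a^-1)%R by rewrite invr_gt0.
pose GR := measurableTypeR R.
pose leb : {sigma_finite_measure set GR -> \bar R} := @lebesgue_measure R.
pose D : set (GR * GR) := [set p | (0 <= p.1)%R /\ (c * p.1 `^ a < p.2)%R].
pose F (p : GR * GR) : \bar R := (expR (- p.2) * \1_D p)%:E.
have mD : measurable D.
  have mpa : measurable_fun [set: GR * GR] (fun p => (c * p.1 `^ a)%R).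
    apply: measurable_funM => //.
    by apply: (measurableT_comp (f := fun t : R => t `^ a)%R) => //;
      exact: measurable_powR.
  rewrite (_ : D = ([set: GR * GR] `&` [set p | (0 <= p.1)%R]) `&`
    ([set: GR * GR] `&` [set p | (c * p.1 `^ a < p.2)%R]));
    last by rewrite !setTI.
  apply: measurableI; first exact: measurable_fun_le.
  under eq_set => p do rewrite -lte_fin.
  by apply: measurable_lte => //; apply/measurable_EFinP.
have F0 p : 0 <= F p by rewrite lee_fin mulr_ge0 ?expR_ge0.
have mF : measurable_fun [set: GR * GR] F.
  apply/measurable_EFinP; apply: measurable_funM; last exact: measurable_indic.
  by apply: (measurableT_comp (f := @expR R)) => //; exact: measurableT_comp.
transitivity (\int[leb]_t \int[leb]_u F (t, u)).
  rewrite integral_mkcond; apply: eq_integral => t _; rewrite patchE.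
  case: ifPn => [|/negP]; rewrite inE/= in_itv/= andbT => t0; last first.
    rewrite integral0_eq// => u _; rewrite /F indicE memNset ?mulr0//.
    by move=> -[].
  have := integral_expR_tail (c * t `^ a)%R (@ltr01 R).
  rewrite mul1r => <-; rewrite integral_mkcond; apply: eq_integral => u _.
  rewrite patchE /F indicE !mul1r.
  rewrite (_ : (_ \in D) = (u \in `](c * t `^ a)%R, +oo[%classic)).
    by case: ifPn; rewrite ?mulr1 ?mulr0.
  by apply/idP/idP; rewrite !inE /D/= in_itv/= andbT => // -[].
rewrite (fubini_tonelli (m1 := leb) (m2 := leb) F mF F0).
transitivity (\int[leb]_(u in `]0%R, +oo[)
    ((c `^ (- a^-1))%:E * (u `^ a^-1 * expR (- u))%:E)).
  rewrite [RHS]integral_mkcond; apply: eq_integral => u _; rewrite patchE.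
  case: ifPn => [|/negP]; rewrite inE/= in_itv/= andbT => u0; last first.
    rewrite integral0_eq// => t _; rewrite /F indicE memNset ?mulr0//.
    move=> -[/= t0 cu]; apply: u0; apply: le_lt_trans cu.
    by rewrite mulr_ge0 ?powR_ge0 ?ltW.
  have ucge0 : (0 <= u / c)%R by rewrite divr_ge0 ?ltW.
  have mDu : measurable [set t : GR | D (t, u)].
    have := measurable_ysection u mD.
    by rewrite (_ : ysection D u = [set t | D (t, u)])//; apply/seteqP;
      split => t; rewrite /ysection/= inE.
  rewrite -EFinM mulrA -(_ : (u / c) `^ a^-1 = c `^ (- a^-1) * u `^ a^-1)%R;
    last by rewrite powRM ?invr_ge0 ?ltW// -(powR_inv1 (ltW c0)) -powRrM
      mulN1r mulrC.
  rewrite mulrC EFinM -[X in _ = _ * X](lebesgue_measure_below).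
    rewrite -[in RHS]/leb.
    transitivity (\int[leb]_t
        ((expR (- u))%:E * (\1_[set t : GR | D (t, u)] t)%:E)).
      apply: eq_integral => t _; rewrite /F EFinM !indicE; congr (_ * _%:R%:E).
    rewrite ge0_integralZl ?lee_fin ?expR_ge0//; last first.
      exact/measurable_EFinP/measurable_indic.
    rewrite integral_indic// setIT; congr (_ * leb _).
    apply/seteqP; split => t [/= t0 lt_t]; split => //=; move: lt_t;
      by rewrite lte_fin ltr_powRVr// ltr_pdivlMr// mulrC.
  by rewrite lee_fin powR_ge0.
rewrite ge0_integralZl//.
- by rewrite -GammaE.
- apply/measurable_EFinP/measurable_funTS; apply: measurable_funM.
    exact: measurable_powR.
  by apply: measurableT_comp => //; exact: measurableT_comp.
- by move=> u _; rewrite lee_fin mulr_ge0 ?powR_ge0 ?expR_ge0.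
- by rewrite lee_fin powR_ge0.
Qed.

(** * The bound under superregularity *)

(** The tail function is [h t = expR (- b * min (t ^ (1/k)) delta ^ m)]: beyond
    [delta] superregularity gives nothing better than its value at [delta]. Its
    [n]-th power is at most the sum of the two exponentials obtained by replacing
    the minimum with either argument, and these give the two terms. *)
Lemma quantization_error_le (R : realType) (dX dY d : measure_display)
    (TX : measurableType dX) (TY : measurableType dY) (Q : probability TY R)
    (rho : TX * TY -> \bar R) (Omega : measurableType d)
    (P : probability Omega R) (X : {RV P >-> TX})
    (k m b delta T : R) (n : nat) :
  distortion_function rho ->
  (0 < k)%R -> (0 < m)%R -> (0 < b)%R -> (0 < delta)%R -> (0 <= T)%R ->
  (\forall y \ae Q, forall x, rho (x, y) <= T%:E) ->
  (forall x r, (0 < r <= delta)%R ->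
    (b * r `^ m)%:E <= Q [set y | rho (x, y) < (r `^ k)%:E]) ->
  (0 < n)%N ->
  quantization_error X rho n <=
    ((n%:R * b) `^ (- (k / m)) * Gamma (1 + k / m) +
      T * expR (- (n%:R * b * delta `^ m)))%:E.
Proof.
move=> drho k0 m0 b0 delta0 T0 rhoT Qreg n_gt0.
have [mrho rho0] := drho.
have ik0 : (0 < k^-1)%R by rewrite invr_gt0.
pose h (t : R) := expR (- (b * Num.min (t `^ k^-1) delta `^ m))%R.
have mh : measurable_fun [set: R] h.
  apply: measurableT_comp => //; apply: measurableT_comp => //.
  apply: measurable_funM => //.
  apply: (measurableT_comp (measurable_powR m)) => //.
  by apply: measurable_minr => //; exact: measurable_powR.
have h0 t : (0 <= h t)%R by exact: expR_ge0.
have Qh x t : (0 <= t)%R -> Q [set y | t%:E < rho (x, y)] <= (h t)%:E.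
  move=> t0; rewrite /h; set r := Num.min _ _.
  have mrhox : measurable_fun [set: TY] (fun y => rho (x, y)).
    by apply: measurableT_comp => //; exact: pair1_measurable.
  have mlt c : measurable [set y | rho (x, y) < c].
    by rewrite -[X in measurable X]setTI; exact: measurable_lte.
  have mgt c : measurable [set y | c < rho (x, y)].
    by rewrite -[X in measurable X]setTI; exact: measurable_lte.
  have [r0|r0] := ltP 0%R r; last first.
    have -> : r = 0%R.
      by apply/eqP; rewrite eq_le r0 le_min powR_ge0 ltW.
    rewrite powR0 ?gt_eqF// mulr0 oppr0 expR0; exact: probability_le1.
  have r_le : (0 < r <= delta)%R by rewrite r0 ge_min lexx orbT.
  apply: (@le_trans _ _ (Q (~` [set y | rho (x, y) < (r `^ k)%:E]))).
    apply: le_measure; rewrite ?inE//; first exact: measurableC.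
    move=> y /= lt_t; apply/negP.
    rewrite -leNgt (le_trans _ (ltW lt_t))// lee_fin.
    have tk : ((t `^ k^-1) `^ k = t)%R.
      by rewrite -powRrM mulVf ?gt_eqF// powRr1.
    rewrite -[leRHS]tk; apply: ge0_ler_powR;
      rewrite ?nnegrE ?powR_ge0 ?(ltW k0) ?(ltW r0)//.
    by rewrite ge_min lexx.
  rewrite probability_setC// (le_trans (leeB (lexx 1) (Qreg x r r_le)))//.
  by rewrite -EFinB lee_fin; exact: expR_ge1Dx.
apply: (le_trans (quantization_error_le_integral X drho rhoT mh h0 Qh n_gt0)).
pose g (t : R) := expR (- (n%:R * b * t `^ (m / k))).
have mg : measurable_fun [set: R] g.
  apply: measurableT_comp => //; apply: measurableT_comp => //.
  by apply: measurable_funM => //; exact: measurable_powR.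
set q := expR _.
apply: (@le_trans _ _
    (\int[lebesgue_measure]_(t in `[0%R, T[) ((g t)%:E + q%:E))).
  apply: ge0_le_integral => //.
  - by move=> t _; rewrite lee_fin exprn_ge0.
  - by apply/measurable_EFinP/measurable_funTS/measurable_funX.
  - by apply: emeasurable_funD => //; apply/measurable_EFinP/measurable_funTS.
  move=> t; rewrite /= in_itv/= => /andP[t0 _]; rewrite -EFinD lee_fin.
  rewrite /h -expRM_natl mulrN mulrA.
  rewrite minEle; case: ifPn => _.
    by rewrite -powRrM (mulrC k^-1%R) lerDl expR_ge0.
  by rewrite lerDr expR_ge0.
rewrite ge0_integralD//=; first last.
- by move=> t _; rewrite lee_fin expR_ge0.
- by apply/measurable_EFinP/measurable_funTS.
- by move=> t _; rewrite lee_fin expR_ge0.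
rewrite EFinD; apply: leeD; last first.
  rewrite integral_cst//= lebesgue_measure_itv/= lte_fin.
  case: ifPn => _; first by rewrite oppr0 adde0 -EFinM mulrC.
  by rewrite mule0 lee_fin mulr_ge0 ?expR_ge0.
rewrite -invf_div -integral_expR_powR ?divr_gt0 ?mulr_gt0 ?ltr0n//.
apply: ge0_subset_integral => //.
- by apply/measurable_EFinP/measurable_funTS.
- by move=> t _; rewrite lee_fin expR_ge0.
- by move=> t /=; rewrite !in_itv/= => /andP[->].
Qed.

(** * Asymptotics *)

Lemma limn_esup_le_near (R : realType) (u : (\bar R)^nat) (l : \bar R) :
  (\forall n \near \oo, u n <= l) -> limn_esup u <= l.
Proof.
move=> [N _ ul]; apply: (@le_trans _ _ (ereal_sup (u @` [set n | (N <= n)%N]))).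
  by apply: ereal_inf_lbound => /=; exists [set n | (N <= n)%N] => //; exists N.
by apply: ge_ereal_sup => _ [n /= Nn <-]; exact: ul.
Qed.

Lemma near_le_ln (R : realType) (B : R) : \forall n \near \oo, (B <= ln n%:R)%R.
Proof.
near=> n.
have Bn : (expR B <= n%:R)%R by near: n; exact: nbhs_infty_ger.
by rewrite -ler_expR lnK// posrE (lt_le_trans _ Bn) ?expR_gt0.
Unshelve. all: by end_near. Qed.

(** By [powR_le_expR] with rate [c / 2], the left-hand side is at most a constant
    times the geometric sequence [expR (- c / 2) ^+ n]. *)
Lemma near_powR_expR_le (R : realType) (T p c e : R) :
  (0 <= T -> 0 < p -> 0 < c -> 0 < e ->
  \forall n \near \oo, T * (n%:R `^ p * expR (- (n%:R * c))) <= e)%R.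
Proof.
move=> T0 p0 c0 e0.
have c20 : (0 < c / 2)%R by rewrite divr_gt0.
pose K := (T * (p / (c / 2)) `^ p)%R.
have cvgK : (fun n : nat => K * expR (- (c / 2)) ^+ n)%R @ \oo --> (0 : R)%R.
  rewrite -[X in _ --> X](mulr0 K); apply: cvgM; first exact: cvg_cst.
  by apply: cvg_expr; rewrite ger0_norm ?expR_ge0// expR_lt1 oppr_lt0.
near=> n.
apply: (@le_trans _ _ (K * expR (- (c / 2)) ^+ n)%R).
  rewrite /K -mulrA ler_wpM2l// -expRM_natl.
  rewrite [leRHS](_ : _ = (p / (c / 2)) `^ p * expR (c / 2 * n%:R) *
      expR (- (n%:R * c)))%R.
    by rewrite ler_wpM2r ?expR_ge0// powR_le_expR.
  by rewrite -mulrA -expRD; congr (_ * expR _)%R; field.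
by near: n; apply: (cvgr_le _ cvgK).
Unshelve. all: by end_near. Qed.

Lemma near_powRN_le (R : realType) (C p e : R) :
  (0 <= C -> 0 < p -> 0 < e -> \forall n \near \oo, C * n%:R `^ (- p) <= e)%R.
Proof.
move=> C0 p0 e0; near=> n.
have n0 : (0 < n%:R :> R)%R by rewrite ltr0n; near: n; exact: nbhs_infty_gt.
have C1 : (0 < C + 1)%R by rewrite ltr_wpDl.
apply: (@le_trans _ _ ((C + 1) * n%:R `^ (- p))%R).
  by rewrite ler_wpM2r ?powR_ge0// lerDl.
rewrite /powR gt_eqF// -[X in (X * _ <= _)%R](lnK C1) -[leRHS](lnK e0) -expRD.
rewrite ler_expR mulNr lerBlDr -lerBlDl -ler_pdivrMl//.
by near: n; exact: near_le_ln.
Unshelve. all: by end_near. Qed.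

(** From [V n <= C * n ^ (- k / m)] follows
    [ln (V n)^-1 >= k / m * ln n - ln C], and [ln C] is negligible before
    [ln n]. *)
Lemma limn_esup_log_ratio_le (R : realType) (V : (\bar R)^nat) (k m C : R) :
  (0 < k)%R -> (0 < m)%R -> (0 < C)%R ->
  (forall n, 0 <= V n) ->
  (\forall n \near \oo, V n <= (C * n%:R `^ (- (k / m)))%:E) ->
  limn_esup (fun n =>
    if V n == 0 then 0 else (k * ln n%:R)%:E / lne (V n)^-1) <= m%:E.
Proof.
move=> k0 m0 C0 V0 VC.
have p0 : (0 < k / m)%R by rewrite divr_gt0.
apply/lee_addgt0Pr => e e0; apply: limn_esup_le_near; near=> n.
case: ifPn => [_|Vn0]; first by rewrite -EFinD lee_fin addr_ge0 ?ltW.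
have VnC : V n <= (C * n%:R `^ (- (k / m)))%:E by near: n.
have : 0 < V n by rewrite lt0e Vn0 V0.
case: (V n) VnC => [v| |] //; rewrite lee_fin lte_fin => vC v0.
have n1 : (1 < n%:R :> R)%R by rewrite ltr1n; near: n; exact: nbhs_infty_gt.
have n0 : (0 < n%:R :> R)%R by rewrite (lt_trans _ n1).
have lnn0 : (0 < ln n%:R :> R)%R by rewrite ln_gt0.
have lnv : (k / m * ln n%:R - ln C <= - ln v)%R.
  rewrite lerNr opprB -ler_expR expRD !lnK ?posrE//.
  by move: vC; rewrite /powR gt_eqF// mulNr.
have knm : (k * ln n%:R <= (m + e) * (k / m * ln n%:R - ln C))%R.
  (* This threshold is the solution of the inequality for [ln n]. *)
  have : ((m + e) * ln C / (e * (k / m)) <= ln n%:R)%R.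
    by near: n; exact: near_le_ln.
  rewrite ler_pdivrMr ?(mulr_gt0 e0 p0)// => lnC.
  rewrite mulrBr lerBrDr [leRHS]mulrDl.
  rewrite (_ : m * (k / m * ln n%:R) = k * ln n%:R)%R.
    by rewrite lerD2l (le_trans lnC)// [leRHS]mulrA [leRHS]mulrC.
  by field; rewrite gt_eqF.
have me0 : (0 < m + e)%R by rewrite addr_gt0.
have L0 : (0 < - ln v)%R.
  apply: lt_le_trans lnv; rewrite -(pmulr_rgt0 _ me0).
  by apply: lt_le_trans knm; rewrite mulr_gt0.
rewrite inver gt_eqF// lne_EFin ?invr_gt0// lnV ?posrE// inver gt_eqF//.
rewrite -EFinM -EFinD lee_fin ler_pdivrMr// (le_trans knm)//.
by rewrite (ler_pM2l me0).
Unshelve. all: by end_near. Qed.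

Lemma quantization_error_ge0 (R : realType) (dX dY d : measure_display)
    (TX : measurableType dX) (TY : measurableType dY)
    (rho : TX * TY -> \bar R) (Omega : measurableType d)
    (P : probability Omega R) (X : {RV P >-> TX}) (n : nat) :
  distortion_function rho -> 0 <= quantization_error X rho n.
Proof.
move=> [_ rho0]; apply: le_ereal_inf_tmp => _ [f _ <-]; exact: integral_ge0.
Qed.

(** The factor [n ^ (k / m)] cancels the decay of the Gamma term, and the
    exponential term remains negligible after multiplication by it. *)
Lemma near_scaled_quantization_error_le (R : realType) (dX dY d : measure_display)
    (TX : measurableType dX) (TY : measurableType dY) (Q : probability TY R)
    (rho : TX * TY -> \bar R) (Omega : measurableType d)
    (P : probability Omega R) (X : {RV P >-> TX}) (k m b delta T : R) :
  distortion_function rho ->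
  (0 < k)%R -> (0 < m)%R -> (0 < b)%R -> (0 < delta)%R -> (0 <= T)%R ->
  (\forall y \ae Q, forall x, rho (x, y) <= T%:E) ->
  (forall x r, (0 < r <= delta)%R ->
    (b * r `^ m)%:E <= Q [set y | rho (x, y) < (r `^ k)%:E]) ->
  forall e, (0 < e)%R -> \forall n \near \oo,
  (n%:R `^ (k / m))%:E * quantization_error X rho n <=
    (Gamma (1 + k / m) * b `^ (- (k / m)) + e)%:E.
Proof.
move=> drho k0 m0 b0 delta0 T0 rhoT Qreg e e0.
have p0 : (0 < k / m)%R by rewrite divr_gt0.
have c0 : (0 < b * delta `^ m)%R by rewrite mulr_gt0// powR_gt0.
near=> n.
have n0 : (0 < n)%N by near: n; exact: nbhs_infty_gt.
have n0R : (0 < n%:R :> R)%R by rewrite ltr0n.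
have Vn := quantization_error_le X drho k0 m0 b0 delta0 T0 rhoT Qreg n0.
apply: (le_trans (lee_wpmul2l _ Vn)); first by rewrite lee_fin powR_ge0.
rewrite -EFinM lee_fin mulrDr (powRM _ (ltW n0R) (ltW b0)) lerD//.
  by rewrite !mulrA powRN mulfV ?gt_eqF ?powR_gt0// mul1r mulrC.
rewrite mulrCA -mulrA.
by near: n; exact: near_powR_expR_le.
Unshelve. all: by end_near. Qed.

(** * Upper quantization dimension and coefficient *)

Lemma poweRV_lt (R : realType) (x : \bar R) (k r : R) :
  (0 < k)%R -> (0 <= r)%R -> 0 <= x ->
  (x `^ k^-1 < r%:E) = (x < (r `^ k)%:E).
Proof.
move=> k0 r0; case: x => [t|_|//].
  rewrite lee_fin poweR_EFin !lte_fin => t0.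
  by rewrite -[in RHS](invrK k) ltr_powRVr ?invr_gt0.
by rewrite poweRyr ?invr_eq0 ?gt_eqF.
Qed.

(** The measure [mu] itself; the proof argument gives the canonical structure of
    probability something to depend on. *)
Definition unit_measure (R : realType) (d : measure_display)
    (T : measurableType d) (mu : {measure set T -> \bar R})
    (mu1 : mu [set: T] = 1) : set T -> \bar R := mu.

HB.instance Definition _ (R : realType) (d : measure_display)
    (T : measurableType d) (mu : {measure set T -> \bar R})
    (mu1 : mu [set: T] = 1) :=
  Measure.copy (unit_measure mu1) mu.

HB.instance Definition _ (R : realType) (d : measure_display)
    (T : measurableType d) (mu : {measure set T -> \bar R})
    (mu1 : mu [set: T] = 1) :=
  Measure_isProbability.Build _ _ _ (unit_measure mu1) mu1.

Theorem corollary4p3 (R : realType) (dX dY d : measure_display)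
    (TX : measurableType dX) (TY : measurableType dY)
    (singletonX : forall x : TX, measurable [set x])
    (singletonY : forall y : TY, measurable [set y])
    (nu : {measure set TY -> \bar R}) (nu1 : nu [set: TY] = 1)
    (rho : TX * TY -> \bar R) (distortion_rho : distortion_function rho)
    (k : R) (k_gt0 : (0 < k)%R)
    (m b : R) (delta0 : \bar R) (m_gt0 : (0 < m)%R)
    (superregular_nu : superregular (fun z => rho z `^ k^-1) nu m b delta0)
    (ess_sup_lty : delta0 < +oo ->
      ess_sup nu (fun y => ereal_sup [set rho (x, y) `^ k^-1 | x in [set: TX]])
        < +oo)
    (Omega : measurableType d) (P : probability Omega R) (X : {RV P >-> TX}) :
  upper_quantization_dim X rho k <= m%:E /\
  (is_quantization_dim X rho k m%:E ->
   upper_quantization_coef X rho k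
     <= (Gamma (1 + k / m) * b `^ (- (k / m)))%:E).
Proof.
have [drm drho0] := distortion_rho.
pose Q : probability TY R := unit_measure nu1.
have [_ b0 delta0_gt0 reg] := superregular_nu.
have reg' x r : (0 < r)%R -> r%:E < delta0 ->
    (b * r `^ m)%:E <= Q [set y | rho (x, y) < (r `^ k)%:E].
  move=> r0 /(reg x _ r0); congr (_ <= nu _).
  by apply/seteqP; split => y /=; rewrite poweRV_lt// ltW.
(* At radius [(2 / b) ^ (1 / m)] the lower bound [b * r ^ m] would be [2]. *)
have delta0_lty : delta0 < +oo.
  rewrite ltey; apply/eqP => delta0y.
  have r0 : (0 < (2 / b) `^ m^-1)%R by apply: powR_gt0; exact: divr_gt0.
  have msmall :
      measurable [set y | rho (point, y) < (((2 / b) `^ m^-1) `^ k)%:E].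
    rewrite -[X in measurable X]setTI; apply: measurable_lte => //.
    by apply: measurableT_comp => //; exact: pair1_measurable.
  have := reg' point _ r0; rewrite delta0y => /(_ (ltry _)).
  move=> /le_trans/(_ (probability_le1 Q msmall)).
  have b2 : (0 <= 2 / b)%R by rewrite divr_ge0// ltW.
  rewrite -powRrM mulVf ?gt_eqF// powRr1//.
  by rewrite mulrCA mulfV ?gt_eqF// mulr1 lee_fin lern1.
pose delta := (fine delta0 / 2)%R.
have delta_gt0 : (0 < delta)%R.
  by rewrite divr_gt0// fine_gt0// delta0_gt0.
have delta_lt : delta%:E < delta0.
  rewrite -[ltRHS]fineK; last by rewrite gt0_fin_numE.
  by rewrite lte_fin ltr_pdivrMr// ltr_pMr ?ltr1n// fine_gt0// delta0_gt0.
set S := (S in ess_sup _ S) in ess_sup_lty.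
have [T T0 rhoT] : exists2 T : R, (0 <= T)%R &
    \forall y \ae Q, forall x, rho (x, y) <= T%:E.
  (* The maximum with [0] keeps the bound from being [-oo]. *)
  pose a := fine (maxe 0 (ess_sup nu S)).
  have aE : a%:E = maxe 0 (ess_sup nu S).
    rewrite fineK// ge0_fin_numE ?le_max ?lexx//.
    by rewrite gt_max ltry ess_sup_lty.
  have a0 : (0 <= a)%R by rewrite -lee_fin aE le_max lexx.
  exists (a `^ k)%R; first exact: powR_ge0.
  apply: filterS (ess_sup_ge nu S) => y Sy x.
  have : rho (x, y) `^ k^-1 <= a%:E.
    rewrite aE le_max; apply/orP; right; apply: le_trans Sy.
    by apply: ereal_sup_ubound; exists x.
  move=> /(gt0_ler_poweR (ltW k_gt0)).
  rewrite !in_itv/= !leey poweR_ge0 lee_fin a0.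
  by rewrite -poweRrM mulVf ?gt_eqF// poweRe1// => /(_ isT isT).
have Qreg x r : (0 < r <= delta)%R ->
    (b * r `^ m)%:E <= Q [set y | rho (x, y) < (r `^ k)%:E].
  move=> /andP[r0 r_le]; apply: reg' => //.
  by apply: le_lt_trans delta_lt; rewrite lee_fin.
have scaled := near_scaled_quantization_error_le X distortion_rho k_gt0 m_gt0 b0
  delta_gt0 T0 rhoT Qreg.
set A := (Gamma _ * _)%R in scaled *.
have p0 : (0 < k / m)%R by rewrite divr_gt0.
have V0 n : 0 <= quantization_error X rho n by exact: quantization_error_ge0.
(* The absolute value makes the constant visibly positive. *)
have C0 : (0 < `|A| + 1)%R by rewrite ltr_wpDl.
have VC : \forall n \near \oo,
    quantization_error X rho n <= ((`|A| + 1) * n%:R `^ (- (k / m)))%:E.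
  near=> n.
  have n0 : (0 < n%:R :> R)%R by rewrite ltr0n; near: n; exact: nbhs_infty_gt.
  have : (n%:R `^ (k / m))%:E * quantization_error X rho n <= (A + 1)%:E.
    by near: n; exact: scaled.
  rewrite powRN -lee_pdivlMl ?powR_gt0// => /le_trans; apply.
  rewrite -EFinM lee_fin mulrC ler_wpM2r ?invr_ge0 ?powR_ge0//.
  by rewrite lerD2r ler_norm.
have limV : quantization_error X rho @ \oo --> 0.
  apply: limn_esup_le_cvg => //; apply/lee_addgt0Pr => e e0; rewrite add0e.
  apply: limn_esup_le_near; near=> n.
  apply: (@le_trans _ _ ((`|A| + 1) * n%:R `^ (- (k / m)))%:E).
    by near: n.
  by rewrite lee_fin; near: n; apply: near_powRN_le => //; exact: ltW.
split.
  rewrite /upper_quantization_dim (cvg_lim _ limV)// ltxx.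
  exact: limn_esup_log_ratio_le C0 V0 VC.
move=> [_ dimE]; rewrite /upper_quantization_coef dimE /=.
apply/lee_addgt0Pr => e e0; apply: limn_esup_le_near.
by rewrite -EFinD; exact: scaled.
Unshelve. all: by end_near.
Qed.
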